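(* Let $L$ be an oriented starred link or linkoid diagram in a surface, with $n\ge 1$ (unstarred) crossings and $n$ (unstarred) regions. Then the potential $\nabla_L(W,B)$ is equal to the permanent of the potential matrix $M_L$ of $L$.
   Context: Surfaces are closed, connected and oriented. A linkoid diagram in a surface is a generic immersion of finitely many unit intervals (long components, oriented from tail to head) and circles, with finitely many transverse double points, each carrying over/under information (crossings); endpoints of the long components are distinct from each other and from the crossings. A link diagram is the case with only circles. The universe is the graph obtained by turning each crossing into a 4-valent vertex and each endpoint into a 1-valent vertex; regions are the connected components of its complement. Diagrams are assumed tightly embedded (every region is a disk); every diagram in $S^2$ is counted as tightly embedded. A starred diagram is a diagram together with stars placed either on some of its regions or on some of its crossings (possibly no stars) so that the number of unstarred regions equals the number of unstarred crossings. Labels. At each crossing of an oriented diagram there are four local regions (corners): the out-corner (between the two outgoing edges), the in-corner (between the two incoming edges) and two side corners. At a positive crossing the out-corner has label $W$, the in-corner $-B$, and both side corners $1$. At a negative crossing the out-corner has label $B$, the in-corner $-W$, and both side corners $1$. A state of a starred diagram assigns to every unstarred region one marker, placed at a corner of that region at an unstarred crossing, so that every unstarred crossing receives exactly one marker (if a region occupies several corners at one crossing, different corners give different states). The weight $\langle L|S\rangle$ of a state $S$ is the product of the labels of the marked corners. The potential is $\nabla_L(W,B)=\sum_S\langle L|S\rangle$ over all states. The potential matrix $M_L$ of a starred diagram has rows indexed by the unstarred crossings and columns by the unstarred regions; its $(i,j)$ entry is the sum of the labels of the corners at the $i$-th crossing that belong to the $j$-th region ($0$ if there are none). The permanent of an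 $n\times n$ matrix $M$ is $\sum_{\sigma\in S_n}\prod_{i=1}^n M_{i\sigma(i)}$. *)

(* Defs.v *)
From HB Require Import structures.
From mathcomp Require Import all_boot all_order all_algebra all_fingroup.
From mathcomp Require Import mpoly.

Set Implicit Arguments.
Unset Strict Implicit.
Unset Printing Implicit Defensive.

Import GRing.Theory.
Local Open Scope ring_scope.

(* Linkoid diagrams in closed connected oriented surfaces, up to orientation
   preserving homeomorphism, encoded as combinatorial maps.

   A crossing [x] has four half-edges [(x, i)], [i : 'I_4], in counterclockwise
   order; those with [i] even form the under-strand and those with [i] odd the
   over-strand.  An endpoint of a long component has one half-edge.  Circle
   components without crossings contribute no vertex to the universe and are
   recorded separately. *)

Definition half_edge (crossing endpoint : finType) : finType :=
  (crossing * 'I_4 + endpoint)%type.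

(* A half-edge, seen from its vertex, stands for its left-hand side; [(c, true)]
   and [(c, false)] are the left and right sides of the crossingless oriented
   circle [c]. *)
Definition side (crossing endpoint circle : finType) : finType :=
  (half_edge crossing endpoint + circle * bool)%type.

Record diagram_data := DiagramData {
  crossing : finType;
  endpoint : finType;
  circle : finType;
  region : finType;
  (* the other half of the same edge *)
  mate : half_edge crossing endpoint -> half_edge crossing endpoint;
  (* the orientation of the component leaves the vertex along the half-edge *)
  outgoing : pred (half_edge crossing endpoint);
  left_region : side crossing endpoint circle -> region
}.

Section Surface.

Variable L : diagram_data.

Local Notation half_edge := (half_edge (crossing L) (endpoint L)).
Local Notation side := (side (crossing L) (endpoint L) (circle L)).

Definition clockwise_next (h : half_edge) : half_edge :=
  match h with
  | inl (x, i) => inl (x, ord_pred i)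
  | inr p => inr p
  end.

Definition other_side (s : side) : side :=
  match s with
  | inl h => inl (mate h)
  | inr (c, b) => inr (c, ~~ b)
  end.

(* Walk along a side, keeping the region on the left; the orbits are the
   boundary cycles of the regions. *)
Definition boundary_next (s : side) : side :=
  match s with
  | inl h => inl (clockwise_next (mate h))
  | inr cb => inr cb
  end.

Definition boundary_cycles (r : region L) : nat :=
  fcard boundary_next [pred s : side | left_region s == r].

Definition adjacent : rel (region L) :=
  [rel r1 r2 | [exists s : side,
     (left_region s == r1) && (left_region (other_side s) == r2)]].

Definition surface_connected : Prop :=
  (0 < #|region L|)%N /\ forall r1 r2 : region L, connect adjacent r1 r2.

(* Euler characteristic of the surface obtained by gluing to a ribbon
   neighbourhood of the diagram, for each region [r], a sphere with
   [boundary_cycles r] holes.  Regions of genus 0 suffice: regions are disks,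
   or else the surface is the sphere. *)
Definition euler_characteristic : int :=
  #|crossing L|%:Z + #|endpoint L|%:Z - (#|half_edge| %/ 2)%N%:Z
  + \sum_(r : region L) (2 - (boundary_cycles r)%:Z).

Definition tightly_embedded : Prop :=
  (forall r : region L, boundary_cycles r = 1%N) \/ euler_characteristic = 2.

End Surface.

Record diagram := Diagram {
  diagram_of :> diagram_data;
  mateK : involutive (@mate diagram_of);
  outgoing_mate : forall h, outgoing (@mate diagram_of h) = ~~ outgoing h;
  outgoing_opposite : forall (x : crossing diagram_of) (i : 'I_4),
    outgoing (inl (x, ordS (ordS i)) : half_edge _ (endpoint diagram_of))
    = ~~ outgoing (inl (x, i) : half_edge _ (endpoint diagram_of));
  left_region_boundary : forall s,
    left_region (@boundary_next diagram_of s) = left_region s;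
  diagram_connected : surface_connected diagram_of;
  diagram_tight : tightly_embedded diagram_of
}.

Record starred_diagram := StarredDiagram {
  underlying :> diagram;
  starred_regions : {set region underlying};
  starred_crossings : {set crossing underlying};
  stars_one_kind : starred_regions = set0 \/ starred_crossings = set0;
  stars_balanced : #|~: starred_regions| = #|~: starred_crossings|
}.

Definition unstarred_region (L : starred_diagram) : finType :=
  {r : region L | r \notin starred_regions L}.

Definition unstarred_crossing (L : starred_diagram) : finType :=
  {x : crossing L | x \notin starred_crossings L}.

Section Potential.

Variable L : starred_diagram.

(* The corner [(x, i)] at the crossing [x] is the sector from the half-edge
   [(x, i)] counterclockwise to [(x, i + 1)]. *)
Definition corner : finType := (crossing L * 'I_4)%type.

Definition corner_region (k : corner) : region L := left_region (inl (inl k)).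

Definition leaves (k : corner) : bool :=
  outgoing (inl k : half_edge (crossing L) (endpoint L)).

Definition out_corner (k : corner) : bool := leaves k && leaves (k.1, ordS k.2).

Definition in_corner (k : corner) : bool :=
  ~~ leaves k && ~~ leaves (k.1, ordS k.2).

(* The outgoing over-strand turns counterclockwise to the outgoing
   under-strand. *)
Definition positive (x : crossing L) : bool :=
  [exists i : 'I_4, odd i && out_corner (x, i)].

Definition W : {mpoly int[2]} := 'X_0.
Definition B : {mpoly int[2]} := 'X_1.

Definition label (k : corner) : {mpoly int[2]} :=
  if positive k.1 then
    if out_corner k then W else if in_corner k then - B else 1
  else
    if out_corner k then B else if in_corner k then - W else 1.

Definition is_state (S : {ffun unstarred_region L -> corner}) : bool :=
  [&& [forall r, corner_region (S r) == val r],
      [forall r, (S r).1 \notin starred_crossings L]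
    & [forall x : unstarred_crossing L, #|[set r | (S r).1 == val x]| == 1%N]].

Definition weight (S : {ffun unstarred_region L -> corner}) : {mpoly int[2]} :=
  \prod_(r : unstarred_region L) label (S r).

Definition potential : {mpoly int[2]} :=
  \sum_(S : {ffun unstarred_region L -> corner} | is_state S) weight S.

(* [xs] and [rs] list the unstarred crossings and the unstarred regions. *)
Definition potential_matrix (n : nat)
    (xs : 'I_n -> unstarred_crossing L) (rs : 'I_n -> unstarred_region L) :
    'M[{mpoly int[2]}]_n :=
  \matrix_(i, j) \sum_(k : 'I_4 | corner_region (val (xs i), k) == val (rs j))
    label (val (xs i), k).

End Potential.

Definition permanent (R : comPzRingType) (n : nat) (M : 'M[R]_n) : R :=
  \sum_(s : 'S_n) \prod_(i < n) M i (s i).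

(* Main.v *)
Require Import Defs.
From mathcomp Require Import all_boot all_order all_algebra all_fingroup.
From mathcomp Require Import mpoly.

(* Expanding the products of sums in the permanent yields one term for each
   choice of a permutation [s] and of a corner [f i] at each crossing [xs i]
   lying in the region [rs (s i)]. A state is the same thing as such a pair: the
   permutation is the bijection between crossings and regions induced by the
   markers, and [f] tells which of the four corners are marked. *)

Set Implicit Arguments.
Unset Strict Implicit.
Unset Printing Implicit Defensive.

Local Open Scope ring_scope.

(** For a fixed permutation, distributivity turns the product of sums into a sum over choice
    functions. Below, [K] is ['I_4], the corners at a crossing. *)
Lemma permanent_sum (R : comPzRingType) (n : nat) (K : finType)
    (Q : 'I_n -> 'I_n -> pred K) (F : 'I_n -> K -> R) :
  permanent (\matrix_(i, j) \sum_(k | Q i j k) F i k) =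
  \sum_(p : 'S_n * {ffun 'I_n -> K} | [forall i, Q i (p.1 i) (p.2 i)])
    \prod_i F i (p.2 i).
Proof.
rewrite /permanent.
under eq_bigr => s _.
  under eq_bigr => i _ do rewrite mxE.
  rewrite bigA_distr_big_dep.
  over.
rewrite (pair_big_dep xpredT) /=; apply: eq_bigl => p.
by apply/familyP/forallP => h i; have := h i.
Qed.

Definition markers_along (L : starred_diagram) (n : nat)
    (xs : 'I_n -> unstarred_crossing L) (rs : 'I_n -> unstarred_region L)
    (S : {ffun unstarred_region L -> corner L}) (s : 'S_n) : bool :=
  [forall i, (S (rs (s i))).1 == val (xs i)].

(** Send [i] to the index of the region whose marker lies at [xs i]. A marker lies at a single
    crossing, so this self-map of a finite set is injective, hence a permutation. *)
Lemma is_state_markers_along (L : starred_diagram) (n : nat)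
    (xs : 'I_n -> unstarred_crossing L) (rs : 'I_n -> unstarred_region L)
    (S : {ffun unstarred_region L -> corner L}) :
  injective xs -> bijective rs -> is_state S ->
  exists s : 'S_n, markers_along xs rs S s.
Proof.
move=> xs_inj [ir rsK irK] /and3P[_ _ /forallP one_marker].
have marked i : {j | (S (rs j)).1 == val (xs i)}.
  apply: sigW; have /cards1P[r /setP/(_ r)] := one_marker (xs i).
  by rewrite !inE eqxx => Sr; exists (ir r); rewrite irK.
have marked_inj : injective (fun i => sval (marked i)).
  move=> i i' eq_ii'; apply: xs_inj; apply: val_inj.
  by rewrite -(eqP (svalP (marked i))) eq_ii' (eqP (svalP (marked i'))).
by exists (perm marked_inj); apply/forallP => i; rewrite permE (svalP (marked i)).
Qed.

(** Each region has one marker, which determines its crossing: [S] fixes the inverse of the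
    permutation. *)
Lemma markers_along_inj (L : starred_diagram) (n : nat)
    (xs : 'I_n -> unstarred_crossing L) (rs : 'I_n -> unstarred_region L)
    (S : {ffun unstarred_region L -> corner L}) (s t : 'S_n) :
  injective xs -> markers_along xs rs S s -> markers_along xs rs S t -> s = t.
Proof.
move=> xs_inj /forallP hs /forallP ht; apply/permP => i.
rewrite -[t i](permKV s); congr (s _); apply: xs_inj; apply: val_inj.
by rewrite -(eqP (ht i)) -(eqP (hs _)) permKV.
Qed.

Theorem proposition4 (L : starred_diagram) (n : nat) (n_gt0 : (0 < n)%N)
    (xs : 'I_n -> unstarred_crossing L) (xs_bij : bijective xs)
    (rs : 'I_n -> unstarred_region L) (rs_bij : bijective rs) :
  potential L = permanent (potential_matrix xs rs).
Proof.
have xs_inj := bij_inj xs_bij.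
have [ix xsK ixK] := xs_bij; have [ir rsK irK] := rs_bij.
pose state_of (p : 'S_n * {ffun 'I_n -> 'I_4}) :
    {ffun unstarred_region L -> corner L} :=
  [ffun r => let i := (p.1^-1)%g (ir r) in (val (xs i), p.2 i)].
(* The default [1] is arbitrary: every state has such an [s]. *)
pose perm_of S : 'S_n := odflt 1%g [pick s | markers_along xs rs S s].
pose pair_of (S : {ffun unstarred_region L -> corner L}) :=
  (perm_of S, [ffun i => (S (rs (perm_of S i))).2]).
have state_ofE p i : state_of p (rs (p.1 i)) = (val (xs i), p.2 i).
  by rewrite ffunE /= rsK permK.
have perm_ofE S s : markers_along xs rs S s -> perm_of S = s.
  rewrite /perm_of => hs; case: pickP => [t ht | /(_ s)]; last by rewrite hs.
  exact: markers_along_inj ht hs.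
have state_of_along p : markers_along xs rs (state_of p) p.1.
  by apply/forallP => i; rewrite state_ofE.
have state_ofK p : pair_of (state_of p) = p.
  rewrite /pair_of (perm_ofE _ _ (state_of_along p)) [RHS]surjective_pairing.
  by congr pair; apply/ffunP => i; rewrite ffunE state_ofE.
have pair_ofK S : is_state S -> state_of (pair_of S) = S.
  move=> /(is_state_markers_along xs_inj rs_bij)[s hs].
  apply/ffunP => r; rewrite ffunE /= ffunE (perm_ofE _ _ hs) permKV irK.
  move/forallP/(_ ((s^-1)%g (ir r))): hs; rewrite permKV irK => /eqP <-.
  by rewrite -surjective_pairing.
rewrite permanent_sum /potential (reindex_onto _ _ pair_ofK).
apply: eq_big => [p | p _].
  (* Only the first condition on a state constrains [p]; the other two hold for every
     [state_of p]. *)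
  rewrite state_ofK eqxx andbT; apply/and3P/forallP => [[/forallP h _ _] i | h].
    by have := h (rs (p.1 i)); rewrite state_ofE.
  split.
  - apply/forallP => r; have := h ((p.1^-1)%g (ir r)).
    by rewrite permKV irK ffunE.
  - by apply/forallP => r; rewrite ffunE; exact: svalP (xs _).
  (* The only marker at [x] is that of the region which [p.1] matches with [x]. *)
  apply/forallP => x; apply/cards1P; exists (rs (p.1 (ix x))).
  apply/setP => r; rewrite !inE ffunE /= (inj_eq val_inj).
  by rewrite (can2_eq xsK ixK) (can2_eq (permKV _) (permK _)) (can2_eq irK rsK).
(* The weight is a product over regions, the permanent's term one over crossings; the matching given
   by [p.1] identifies them. *)
rewrite /weight (reindex_onto (fun i => rs (p.1 i)) (fun r => (p.1^-1)%g (ir r))) /=.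
  apply: eq_big => [i | i _]; first by rewrite rsK permK eqxx.
  by rewrite state_ofE.
by move=> r _; rewrite permKV irK.
Qed.
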